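(* Let $n\ge2$ be an integer and $b=-n+i$. Let $D\subset\{0,1,\ldots,|b|^2-1\}$ satisfy $d\le n^2/2$ for all $d\in D$ and $|a-a'|\neq1$ for all $a,a'\in D-D$. Let $F=\{z\in\mathbb C: C_D\cap(C_D+z)\neq\emptyset\}$ and, for $\beta\in[0,1]$, let $F_\beta$ be the set of $z\in F$ such that $\dim_B(C_D\cap(C_D+z))=\beta\dim_BC_D$. Then $F_\beta$ is dense in $F$ for every $\beta\in[0,1]$.
   Context: Here $|b|^2=n^2+1$; $D$ is nonempty; $D-D=\{d-d':d,d'\in D\}$; and $C_D=\{\sum_{k\ge1}d_kb^{-k}\in\mathbb C:d_k\in D\}$. The box-counting dimension is $\dim_BV=\lim_{\delta\to0^+}\frac{\log N_\delta(V)}{-\log\delta}$ when the limit exists, where $N_\delta(V)$ is the minimum number of sets of diameter at most $\delta$ needed to cover $V$. Membership $z\in F_\beta$ means that $\dim_B(C_D\cap(C_D+z))$ exists and has the stated value. *)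

(* Defs.v *)
From Stdlib Require Import Reals ZArith.
From Coquelicot Require Import Coquelicot.

Open Scope R_scope.

Definition base (n : Z) : C := (RtoC (- IZR n) + Ci)%C.

Definition difference_set (D : Z -> Prop) (a : Z) : Prop :=
  exists d d' : Z, D d /\ D d' /\ a = (d - d')%Z.

(* The sequence [d] is indexed from 0, so [d k] is the digit of [b^-(k+1)]. *)
Definition radix_set (b : C) (D : Z -> Prop) (z : C) : Prop :=
  exists d : nat -> Z,
    (forall k : nat, D (d k)) /\
    is_series (K := C_AbsRing) (V := C_NormedModule)
      (fun k : nat => (RtoC (IZR (d k)) / b ^ S k)%C) z.

Definition self_intersection (V : C -> Prop) (z x : C) : Prop :=
  V x /\ exists y : C, V y /\ x = (y + z)%C.

(* As an [Rbar] supremum, the diameter of the empty set is [m_infty]. *)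
Definition diam (U : C -> Prop) : Rbar :=
  Lub_Rbar (fun r : R => exists x y : C, U x /\ U y /\ r = Cmod (x - y)).

Definition covered_by (V : C -> Prop) (delta : R) (m : nat) : Prop :=
  exists U : nat -> C -> Prop,
    (forall i : nat, (i < m)%nat -> Rbar_le (diam (U i)) (Finite delta)) /\
    (forall x : C, V x -> exists i : nat, (i < m)%nat /\ U i x).

Definition is_covering_number (V : C -> Prop) (delta : R) (N : nat) : Prop :=
  covered_by V delta N /\
  (forall m : nat, covered_by V delta m -> (N <= m)%nat).

(* "The box-counting dimension of [V] exists and equals [s]", for nonempty [V];
   on the empty set the convention [ln 0 = 0] would give dimension 0. *)
Definition is_box_dim (V : C -> Prop) (s : R) : Prop :=
  exists N : R -> nat,
    (forall delta : R, 0 < delta -> is_covering_number V delta (N delta)) /\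
    filterlim (fun delta : R => ln (INR (N delta)) / - ln delta)
      (at_right 0) (locally s).

Definition F (C_D : C -> Prop) (z : C) : Prop :=
  exists x : C, self_intersection C_D z x.

Definition F_level (C_D : C -> Prop) (beta : R) (z : C) : Prop :=
  F C_D z /\
  exists s : R,
    is_box_dim C_D s /\ is_box_dim (self_intersection C_D z) (beta * s).

Definition dense_in (A B : C -> Prop) : Prop :=
  forall z : C, B z ->
  forall eps : R, 0 < eps -> exists w : C, A w /\ Cmod (w - z) < eps.

(* Main.v *)
Require Import Defs.
From Stdlib Require Import Reals ZArith Lia Lra List ClassicalEpsilon FinFun.
From Coquelicot Require Import Coquelicot.

(** Write [b = -n + i] and let [t] be a sequence with values in [D - D]. If
    the point [w] with digits [t] has no other expansion over [D - D], then
    [C_D] meets [C_D + w] exactly in the points whose [k]-th digit lies in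
    [D] and in [D + t k]. Such a set, where each digit ranges freely over its
    own finite list [A k], has about [#A 0 * ... * #A (k-1)] pieces of size
    [|b|^-k], so its box dimension is the limiting average of [ln #A k]
    divided by [ln |b|]. Hence the dimension can be prescribed by the tail of
    [t]: the digit [0] gives [#A k = #D], while the digit [max D - min D] gives
    [#A k = 1]. Keeping the first [m] digits of a given [z] in [F] moves it by
    [O(|b|^-m)], and using the digit [0] afterwards with asymptotic frequency
    [beta] gives dimension [beta * dim C_D]. The frequency is realised by the
    jumps of the integer part of [k * beta], which keeps the logarithm of the
    number of pieces within a bounded distance of [k * beta * ln #D]. A bounded
    error is all that [moran_set_box_dim] asks for.

    Two facts about the base carry the argument.

    - Uniqueness of expansions over [D - D] ([expansion_unique]). Subtracting
      two expansions of a point gives [0] as a series with integer digits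
      [e k], where [|e k| <= n^2] because the elements of [D] are at most
      [n^2/2], and [e k] is never [1] or [-1]. The imaginary parts [y k] of the
      Gaussian integers obtained by evaluating initial segments of [e] in base
      [b] satisfy the recurrence of the polynomial [X^2 + 2nX + n^2+1] of [b]
      with right-hand side [e]. They stay bounded because the series is [0],
      and the large constant coefficient then forces them to be tiny
      ([orbit_le_of_bounded]): the first nonzero digit would have to be [1] or
      [-1] ([orbit_first_digit]).

    - Separation of pieces. Integers in [0..n^2] are pairwise incongruent
      modulo [b], so distinct words of length [k] give distinct Gaussian
      integers ([prefixes_NoDup]). After scaling by [b^k], a set of diameter at
      most [|b|^-k] only sees Gaussian integers in a box of fixed side, hence
      meets a bounded number of pieces ([moran_set_cover_lower]). *)

(** * Bounded solutions of the recurrence attached to the base *)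

(** With [y] the imaginary parts of a sequence of Gaussian integers obeying
    [P (k+1) = b * P k + e k], the coefficients are those of the minimal
    polynomial of [b]. The bound [n * n] is what makes the constant term
    dominate. *)
Definition orbit (n : Z) (e y : nat -> Z) : Prop :=
  forall k : nat,
    (y (S (S k)) + 2 * n * y (S k) + (n * n + 1) * y k = e k)%Z /\
    (Z.abs (e k) <= n * n)%Z.

(** At an index where [|y k| = Y] is maximal the recurrence gives
    [(n^2+1) Y <= n^2 + 2 n Y + Y], that is [(n-2) Y <= n], which fails for
    [n >= 5] and [Y >= 2]. For [n <= 4] one relation does not suffice, but the
    values close to [-Y] or [Y] that it forces contradict the next relation. *)
Lemma orbit_max_le (n : Z) (e y : nat -> Z) (Y : Z) :
  (2 <= n)%Z -> orbit n e y ->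
  (2 <= Y)%Z -> (3 <= n \/ 3 <= Y)%Z ->
  (forall k : nat, (Z.abs (y k) <= Y)%Z) ->
  forall k : nat, (Z.abs (y k) <= Y - 1)%Z.
Proof.
  intros Hn Ho HY HnY Hy k.
  destruct (Ho k) as [E0 B0].
  destruct (Ho (S k)) as [E1 B1].
  pose proof (Hy k) as H0. pose proof (Hy (S k)) as H1.
  pose proof (Hy (S (S k))) as H2. pose proof (Hy (S (S (S k)))) as H3.
  apply Z.abs_le in B0, B1, H0, H1, H2, H3. apply Z.abs_le.
  assert (n = 2 \/ n = 3 \/ n = 4 \/ 5 <= n)%Z as [-> | [-> | [-> | Hn5]]] by lia;
    [lia | lia | lia | ].
  (* The difference of the two sides is [n * ((n - 2) * Y - n)]. *)
  assert (Hc : (2 * n * Y + Y + n * n < (n * n + 1) * Y)%Z).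
  { assert (n * 0 < n * ((n - 2) * Y - n))%Z; [ | lia].
    apply Zmult_lt_compat_l; [lia | ].
    assert ((n - 2) * 2 <= (n - 2) * Y)%Z; [ | lia].
    apply Z.mul_le_mono_nonneg_l; lia. }
  assert (H1l : (2 * n * (- Y) <= 2 * n * y (S k))%Z)
    by (apply Z.mul_le_mono_nonneg_l; lia).
  assert (H1u : (2 * n * y (S k) <= 2 * n * Y)%Z)
    by (apply Z.mul_le_mono_nonneg_l; lia).
  assert (- Y < y k)%Z by (apply (Z.mul_lt_mono_pos_l (n * n + 1)); lia).
  assert (y k < Y)%Z by (apply (Z.mul_lt_mono_pos_l (n * n + 1)); lia).
  lia.
Qed.

(** Repeated use of [orbit_max_le] lowers any bound down to [1], or to [2] when
    [n = 2], where the alternating sequence [2, -2, 2, -2] is a genuine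
    solution. *)
Lemma orbit_le_of_bounded (n : Z) (e y : nat -> Z) (K c : Z) :
  (2 <= n)%Z -> orbit n e y ->
  (1 <= c)%Z -> (3 <= n \/ 2 <= c)%Z ->
  (forall k : nat, (Z.abs (y k) <= K)%Z) ->
  forall k : nat, (Z.abs (y k) <= c)%Z.
Proof.
  intros Hn Ho Hc Hnc HK.
  assert (H : forall j : nat,
             (forall k : nat, (Z.abs (y k) <= c + Z.of_nat j)%Z) ->
             forall k : nat, (Z.abs (y k) <= c)%Z).
  { induction j as [ | j IH]; intros Hj.
    - intros k. specialize (Hj k). lia.
    - apply IH. intros k.
      pose proof (orbit_max_le n e y (c + Z.of_nat (S j)) Hn Ho
                    ltac:(lia) ltac:(lia) Hj k). lia. }
  apply (H (Z.to_nat (K - c))). intros k. specialize (HK k). lia.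
Qed.

(** Starting from [0, 0], the next value is [e k] itself. For [n = 2] the value
    [2] is excluded one step later, since the term after [0, 2] is at most
    [4 - 4 * 2]. *)
Lemma orbit_first_digit (n : Z) (e y : nat -> Z) (K : Z) :
  (2 <= n)%Z -> orbit n e y -> (forall k : nat, (Z.abs (y k) <= K)%Z) ->
  forall k : nat, y k = 0%Z -> y (S k) = 0%Z -> (Z.abs (e k) <= 1)%Z.
Proof.
  intros Hn Ho HK k H0 H1.
  destruct (Ho k) as [E0 B0]. destruct (Ho (S k)) as [E1 B1].
  rewrite H0, H1 in *.
  assert (n = 2 \/ 3 <= n)%Z as [-> | Hn3] by lia.
  - pose proof (orbit_le_of_bounded 2 e y K 2 Hn Ho
                  ltac:(lia) ltac:(lia) HK) as Hb.
    pose proof (Hb (S (S k))). pose proof (Hb (S (S (S k)))). lia.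
  - pose proof (orbit_le_of_bounded n e y K 1 Hn Ho
                  ltac:(lia) ltac:(lia) HK (S (S k))). lia.
Qed.

(** * Radix expansions and their Gaussian integer prefixes *)

Definition gauss (p : Z * Z) : C := (IZR (fst p), IZR (snd p)).

Definition append_digit (n : Z) (p : Z * Z) (a : Z) : Z * Z :=
  (- n * fst p - snd p + a, fst p - n * snd p)%Z.

Fixpoint prefix (n : Z) (d : nat -> Z) (k : nat) : Z * Z :=
  match k with
  | O => (0, 0)%Z
  | S j => append_digit n (prefix n d j) (d j)
  end.

Definition expansion (n : Z) (d : nat -> Z) (z : C) : Prop :=
  is_series (K := C_AbsRing) (V := C_NormedModule)
    (fun k : nat => (RtoC (IZR (d k)) / base n ^ S k)%C) z.

Lemma gauss_append_digit (n : Z) (p : Z * Z) (a : Z) :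
  gauss (append_digit n p a) = (base n * gauss p + RtoC (IZR a))%C.
Proof.
  unfold gauss, append_digit, base, Ci, RtoC, Cplus, Cmult, Copp; simpl.
  rewrite ?plus_IZR, ?minus_IZR, ?mult_IZR, ?opp_IZR.
  rewrite ?plus_IZR, ?minus_IZR, ?mult_IZR, ?opp_IZR.
  f_equal; ring.
Qed.

Lemma Cmod_base_sqr (n : Z) : Cmod (base n) ^ 2 = IZR (n * n + 1).
Proof.
  unfold Cmod, base, Ci, RtoC, Cplus; simpl fst; simpl snd.
  rewrite <- Rsqr_pow2, Rsqr_sqrt by nra.
  rewrite plus_IZR, mult_IZR. ring.
Qed.

Lemma Cmod_base_ge_2 (n : Z) : (2 <= n)%Z -> 2 <= Cmod (base n).
Proof.
  intros Hn.
  pose proof (Cmod_base_sqr n) as H.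
  assert (5 <= IZR (n * n + 1)) by (apply IZR_le; nia).
  pose proof (Cmod_ge_0 (base n)). nra.
Qed.

Lemma base_neq_0 (n : Z) : (2 <= n)%Z -> base n <> RtoC 0.
Proof.
  intros Hn E. pose proof (Cmod_base_ge_2 n Hn) as H.
  rewrite E, Cmod_0 in H. lra.
Qed.

Lemma partial_sum_prefix (n : Z) (d : nat -> Z) (k : nat) :
  (2 <= n)%Z ->
  sum_n (G := C_AbelianMonoid)
    (fun k : nat => (RtoC (IZR (d k)) / base n ^ S k)%C) k =
  (gauss (prefix n d (S k)) / base n ^ S k)%C.
Proof.
  intros Hn. pose proof (base_neq_0 n Hn) as Hb.
  induction k as [ | k IH].
  - rewrite sum_O.
    assert (E : gauss (prefix n d 1) = RtoC (IZR (d 0%nat))).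
    { simpl prefix. rewrite gauss_append_digit.
      change (gauss (0, 0)%Z) with (RtoC 0). ring. }
    rewrite E. reflexivity.
  - rewrite sum_Sn, IH. change plus with Cplus.
    replace (prefix n d (S (S k))) with (append_digit n (prefix n d (S k)) (d (S k)))
      by reflexivity.
    rewrite gauss_append_digit. rewrite (Cpow_S _ (S k)).
    apply (eq_trans (y := (gauss (prefix n d (S k)) / base n ^ S k +
             RtoC (IZR (d (S k))) / (base n * base n ^ S k))%C)); [reflexivity | ].
    field. split; [ apply Cpow_nz | ]; exact Hb.
Qed.

Lemma expansion_iff (n : Z) (d : nat -> Z) (z : C) :
  (2 <= n)%Z ->
  expansion n d z <->
  (forall eps : R, 0 < eps -> exists N : nat, forall k : nat, (N <= k)%nat ->
     Cmod (gauss (prefix n d k) / base n ^ k - z) < eps).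
Proof.
  intros Hn. unfold expansion, is_series.
  rewrite (filterlim_locally_ball_norm (K := C_AbsRing) (U := C_NormedModule)).
  split.
  - intros H eps He. destruct (H (mkposreal eps He)) as [N HN].
    exists (S N). intros [ | k] Hk; [lia | ].
    specialize (HN k ltac:(lia)).
    rewrite partial_sum_prefix in HN by exact Hn. exact HN.
  - intros H eps. destruct (H eps (cond_pos eps)) as [N HN].
    exists N. intros k Hk.
    rewrite partial_sum_prefix by exact Hn. apply HN. lia.
Qed.

Lemma Cmod_IZR (a : Z) : Cmod (RtoC (IZR a)) = IZR (Z.abs a).
Proof. rewrite Cmod_R, abs_IZR. reflexivity. Qed.

(** A geometric tail estimate by induction on [j]: since [|b| >= 2], one more
    digit costs at most [M |b|^-(m+1) <= M (|b|^-m - |b|^-(m+1))]. *)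
Lemma partial_sums_close (n : Z) (d : nat -> Z) (M : Z) (k j : nat) :
  (2 <= n)%Z -> (forall i : nat, (Z.abs (d i) <= M)%Z) ->
  Cmod (gauss (prefix n d (k + j)) / base n ^ (k + j) -
        gauss (prefix n d k) / base n ^ k) <=
  IZR M * (/ Cmod (base n) ^ k - / Cmod (base n) ^ (k + j)).
Proof.
  intros Hn Hd. pose proof (base_neq_0 n Hn) as Hb.
  pose proof (Cmod_base_ge_2 n Hn) as Hb2.
  induction j as [ | j IH].
  - rewrite Nat.add_0_r.
    replace (_ - _)%C with (RtoC 0) by ring. rewrite Cmod_0. lra.
  - rewrite Nat.add_succ_r. set (m := (k + j)%nat) in *.
    replace (gauss (prefix n d (S m)) / base n ^ S m)%C with
      (gauss (prefix n d m) / base n ^ m + RtoC (IZR (d m)) / base n ^ S m)%C.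
    2:{ simpl prefix. rewrite gauss_append_digit, Cpow_S. field.
        split; [apply Cpow_nz | ]; exact Hb. }
    set (u := (gauss (prefix n d m) / base n ^ m)%C) in *.
    set (v := (gauss (prefix n d k) / base n ^ k)%C) in *.
    set (w := (RtoC (IZR (d m)) / base n ^ S m)%C).
    replace (u + w - v)%C with ((u - v) + w)%C by ring.
    eapply Rle_trans; [apply Cmod_triangle | ].
    assert (Hw : Cmod w <= IZR M * / Cmod (base n) ^ S m).
    { unfold w. rewrite Cmod_div by (apply Cpow_nz; exact Hb).
      rewrite Cmod_IZR, Cmod_pow. apply Rmult_le_compat_r.
      - apply Rlt_le, Rinv_0_lt_compat, pow_lt. lra.
      - apply IZR_le, Hd. }
    assert (HM : 0 <= IZR M) by (apply IZR_le; specialize (Hd 0%nat); lia).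
    assert (Hq : 2 * / Cmod (base n) ^ S m <= / Cmod (base n) ^ m).
    { simpl. assert (Hp : 0 < Cmod (base n) ^ m) by (apply pow_lt; lra).
      rewrite Rinv_mult. apply Rinv_0_lt_compat in Hp.
      assert (2 * / Cmod (base n) <= 1).
      { apply Rmult_le_reg_r with (Cmod (base n)); [lra | ]. field_simplify; lra. }
      nra. }
    nra.
Qed.

Lemma scaled_remainder (n : Z) (z p : C) (k : nat) : (2 <= n)%Z ->
  Cmod (base n ^ k * z - p) = Cmod (p / base n ^ k - z) * Cmod (base n) ^ k.
Proof.
  intros Hn. rewrite <- Cmod_pow, <- Cmod_mult.
  rewrite <- Cmod_opp. f_equal. field. apply Cpow_nz, base_neq_0, Hn.
Qed.

(** The remainder after [k] digits, rescaled by [b^k], is again a radix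
    expansion with digits bounded by [M], whence a bound independent of [k].
    Together with its converse [expansion_of_remainder] this replaces
    manipulations of series by comparisons with Gaussian integers. *)
Lemma expansion_remainder (n : Z) (d : nat -> Z) (M : Z) (z : C) :
  (2 <= n)%Z -> (forall i : nat, (Z.abs (d i) <= M)%Z) ->
  expansion n d z ->
  forall k : nat, Cmod (base n ^ k * z - gauss (prefix n d k)) <= IZR M.
Proof.
  intros Hn Hd Hz k. rewrite expansion_iff in Hz by exact Hn.
  pose proof (Cmod_base_ge_2 n Hn) as Hb2.
  assert (Hpk : 0 < Cmod (base n) ^ k) by (apply pow_lt; lra).
  rewrite scaled_remainder by exact Hn.
  apply Rle_div_r; [exact Hpk | ].
  apply le_epsilon. intros eps He.
  destruct (Hz eps He) as [N HN]. specialize (HN (k + N)%nat ltac:(lia)).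
  pose proof (partial_sums_close n d M k N Hn Hd) as Hc.
  assert (HM : 0 <= IZR M) by (apply IZR_le; specialize (Hd 0%nat); lia).
  assert (Hq : 0 < / Cmod (base n) ^ (k + N))
    by (apply Rinv_0_lt_compat, pow_lt; lra).
  set (u := (gauss (prefix n d (k + N)) / base n ^ (k + N))%C) in *.
  set (v := (gauss (prefix n d k) / base n ^ k)%C) in *.
  replace (v - z)%C with ((v - u) + (u - z))%C by ring.
  eapply Rle_trans; [apply Cmod_triangle | ].
  assert (Cmod (v - u) = Cmod (u - v)) as ->
    by (rewrite <- Cmod_opp; f_equal; ring).
  unfold Rdiv. nra.
Qed.

Lemma inv_pow_small (b eps : R) : 1 < b -> 0 < eps ->
  exists N : nat, forall k : nat, (N <= k)%nat -> / b ^ k < eps.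
Proof.
  intros Hb He.
  destruct (Pow_x_infinity b ltac:(rewrite Rabs_pos_eq; lra) (/ eps + 1)) as [N HN].
  exists N. intros k Hk. specialize (HN k Hk).
  assert (0 < b ^ k) by (apply pow_lt; lra).
  rewrite Rabs_pos_eq in HN by lra.
  assert (0 < / eps) by (apply Rinv_0_lt_compat; exact He).
  rewrite <- (Rinv_inv eps). apply Rinv_lt_contravar; nra.
Qed.

Lemma expansion_of_remainder (n : Z) (d : nat -> Z) (K : R) (z : C) :
  (2 <= n)%Z ->
  (forall k : nat, Cmod (base n ^ k * z - gauss (prefix n d k)) <= K) ->
  expansion n d z.
Proof.
  intros Hn Hz. apply expansion_iff; [exact Hn | ]. intros eps He.
  pose proof (Cmod_base_ge_2 n Hn) as Hb2.
  assert (HK : 0 <= K) by (eapply Rle_trans; [apply Cmod_ge_0 | apply (Hz 0%nat)]).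
  destruct (inv_pow_small (Cmod (base n)) (eps / (K + 1))) as [N HN];
    [lra | apply Rdiv_lt_0_compat; lra | ].
  exists N. intros k Hk. specialize (HN k Hk). specialize (Hz k).
  rewrite scaled_remainder in Hz by exact Hn.
  assert (Hp : 0 < Cmod (base n) ^ k) by (apply pow_lt; lra).
  apply Rle_div_r in Hz; [ | exact Hp].
  eapply Rle_lt_trans; [exact Hz | ].
  apply Rmult_lt_compat_r with (r := K + 1) in HN; [ | lra].
  assert (0 < / Cmod (base n) ^ k) by (apply Rinv_0_lt_compat; exact Hp).
  replace (eps / (K + 1) * (K + 1)) with eps in HN by (field; lra).
  unfold Rdiv. nra.
Qed.

Lemma expansion_exists (n : Z) (d : nat -> Z) (M : Z) :
  (2 <= n)%Z -> (forall i : nat, (Z.abs (d i) <= M)%Z) ->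
  exists z : C, expansion n d z.
Proof.
  intros Hn Hd. pose proof (Cmod_base_ge_2 n Hn) as Hb2.
  apply (ex_series_le (K := C_AbsRing) (V := C_CompleteNormedModule)
           _ (fun k => IZR M * (/ Cmod (base n)) ^ S k)).
  - intros k. change norm with Cmod.
    rewrite Cmod_div by (apply Cpow_nz, base_neq_0, Hn).
    rewrite Cmod_IZR, Cmod_pow, pow_inv. apply Rmult_le_compat_r.
    + apply Rlt_le, Rinv_0_lt_compat, pow_lt. lra.
    + apply IZR_le, Hd.
  - apply (ex_series_scal (K := R_AbsRing) (V := R_NormedModule) (IZR M)).
    apply (ex_series_incr_1 (K := R_AbsRing) (V := R_NormedModule)
             (fun k => (/ Cmod (base n)) ^ k)).
    apply ex_series_geom.
    rewrite Rabs_pos_eq by (apply Rlt_le, Rinv_0_lt_compat; lra).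
    apply Rmult_lt_reg_r with (Cmod (base n)); [lra | ].
    rewrite Rinv_l; lra.
Qed.

(** * Uniqueness of expansions *)

Lemma prefix_minus (n : Z) (d d' : nat -> Z) (k : nat) :
  gauss (prefix n (fun j => d j - d' j)%Z k) =
  (gauss (prefix n d k) - gauss (prefix n d' k))%C.
Proof.
  induction k as [ | k IH]; simpl prefix.
  - change (gauss (0, 0)%Z) with (RtoC 0). ring.
  - rewrite !gauss_append_digit, IH, minus_IZR, RtoC_minus. ring.
Qed.

Lemma prefix_orbit (n : Z) (e : nat -> Z) :
  (forall k : nat, (Z.abs (e k) <= n * n)%Z) ->
  orbit n e (fun k => snd (prefix n e k)).
Proof.
  intros He k. split; [ | apply He].
  cbn [prefix]. destruct (prefix n e k) as [x y].
  unfold append_digit. cbn [fst snd]. ring.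
Qed.

Lemma Zabs_snd_gauss_le (p : Z * Z) (r : R) :
  Cmod (gauss p) <= r -> IZR (Z.abs (snd p)) <= r.
Proof.
  intros H. rewrite abs_IZR.
  pose proof (Rmax_Cmod (gauss p)) as Hm.
  pose proof (Rmax_r (Rabs (fst (gauss p))) (Rabs (snd (gauss p)))) as Hr.
  change (snd (gauss p)) with (IZR (snd p)) in *. lra.
Qed.

Lemma Zabs_fst_gauss_le (p : Z * Z) (r : R) :
  Cmod (gauss p) <= r -> IZR (Z.abs (fst p)) <= r.
Proof.
  intros H. rewrite abs_IZR.
  pose proof (Rmax_Cmod (gauss p)) as Hm.
  pose proof (Rmax_l (Rabs (fst (gauss p))) (Rabs (snd (gauss p)))) as Hr.
  change (fst (gauss p)) with (IZR (fst p)) in *. lra.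
Qed.

(** The Gaussian integers of the digitwise difference are bounded by twice the
    remainder bound, so [orbit_first_digit] applies to them. Once all digits
    before [k] agree the Gaussian integer is [0], its successor is real, and
    the digit difference at [k] has absolute value at most [1]. *)
Lemma expansion_unique (n M : Z) (d d' : nat -> Z) (z : C) :
  (2 <= n)%Z ->
  (forall k : nat, (Z.abs (d k) <= M)%Z) ->
  (forall k : nat, (Z.abs (d' k) <= M)%Z) ->
  (forall k : nat, (Z.abs (d k - d' k) <= n * n)%Z) ->
  (forall k : nat, Z.abs (d k - d' k) <> 1%Z) ->
  expansion n d z -> expansion n d' z ->
  forall k : nat, d k = d' k.
Proof.
  intros Hn Hd Hd' He He1 Hz Hz'.
  set (e := (fun k => d k - d' k)%Z).
  assert (HK : forall k : nat, (Z.abs (snd (prefix n e k)) <= 2 * M)%Z).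
  { intros k. apply le_IZR, Zabs_snd_gauss_le.
    unfold e. rewrite prefix_minus, mult_IZR.
    pose proof (expansion_remainder n d M z Hn Hd Hz k) as H.
    pose proof (expansion_remainder n d' M z Hn Hd' Hz' k) as H'.
    set (p := gauss (prefix n d k)) in *. set (p' := gauss (prefix n d' k)) in *.
    replace (p - p')%C with ((base n ^ k * z - p') - (base n ^ k * z - p))%C by ring.
    eapply Rle_trans; [apply Cmod_triangle | ]. rewrite Cmod_opp. lra. }
  assert (Hz0 : forall k : nat, prefix n e k = (0, 0)%Z /\ e k = 0%Z).
  { assert (Hdig : forall k : nat, prefix n e k = (0, 0)%Z -> e k = 0%Z).
    { intros k H0.
      pose proof (orbit_first_digit n e _ (2 * M) Hn (prefix_orbit n e He) HK k) as H.
      simpl in H. rewrite H0 in H. simpl in H. specialize (H ltac:(lia) ltac:(lia)).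
      specialize (He1 k). unfold e in *. lia. }
    intros k. induction k as [ | k [IH1 IH2]].
    - split; [ | apply Hdig]; reflexivity.
    - assert (H : prefix n e (S k) = (0, 0)%Z).
      { simpl. rewrite IH1, IH2. unfold append_digit; simpl. f_equal; lia. }
      split; [exact H | apply Hdig, H]. }
  intros k. destruct (Hz0 k) as [_ H]. unfold e in H. lia.
Qed.

(** * Counting the pieces of a set with independent digits *)

(** A homogeneous Moran set of base [b]. Both [C_D], with [A] constant, and its
    intersections with translates are of this form. *)
Definition moran_set (n : Z) (A : nat -> list Z) (x : C) : Prop :=
  exists d : nat -> Z, (forall k : nat, In (d k) (A k)) /\ expansion n d x.

Definition digit_list (n : Z) (l : list Z) : Prop :=
  NoDup l /\ l <> nil /\ forall a : Z, In a l -> (0 <= a <= n * n)%Z.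

Fixpoint prefixes (n : Z) (A : nat -> list Z) (k : nat) : list (Z * Z) :=
  match k with
  | O => (0, 0)%Z :: nil
  | S j => map (fun pa => append_digit n (fst pa) (snd pa))
             (list_prod (prefixes n A j) (A j))
  end.

(** Equality of the two results makes [a - a'] a multiple of [b], hence of
    [|b|^2 = n^2 + 1] since it is an integer. *)
Lemma append_digit_inj (n : Z) (p p' : Z * Z) (a a' : Z) :
  (0 <= a <= n * n)%Z -> (0 <= a' <= n * n)%Z ->
  append_digit n p a = append_digit n p' a' -> p = p' /\ a = a'.
Proof.
  destruct p as [x y], p' as [x' y']. unfold append_digit; simpl.
  intros Ha Ha' E. injection E as E1 E2.
  assert (H : ((n * n + 1) * (y - y') = a - a')%Z) by nia.
  assert (y = y') as -> by nia.
  split; [f_equal | ]; lia.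
Qed.

Lemma NoDup_list_prod {T U : Type} (l : list T) (l' : list U) :
  NoDup l -> NoDup l' -> NoDup (list_prod l l').
Proof.
  intros H H'. induction H as [ | a l Ha Hl IH]; simpl; [constructor | ].
  apply NoDup_app; [ | exact IH | ].
  - apply Injective_map_NoDup; [ | exact H'].
    intros u v E. injection E as E. exact E.
  - intros [t u] Ht Hp. apply in_map_iff in Ht. destruct Ht as [v [E _]].
    injection E as E1 E2. subst t. apply in_prod_iff in Hp. tauto.
Qed.

Lemma prefixes_NoDup (n : Z) (A : nat -> list Z) (k : nat) :
  (forall j : nat, digit_list n (A j)) -> NoDup (prefixes n A k).
Proof.
  intros HA. induction k as [ | k IH]; simpl.
  - constructor; [intros [] | constructor].
  - destruct (HA k) as [Hnd [_ Hb]].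
    apply Injective_map_NoDup_in.
    + intros [p a] [p' a'] H H' E. simpl in E.
      apply in_prod_iff in H, H'.
      destruct (append_digit_inj n p p' a a') as [-> ->]; try tauto; apply Hb; tauto.
    + apply NoDup_list_prod; assumption.
Qed.

Lemma prefix_in_prefixes (n : Z) (A : nat -> list Z) (d : nat -> Z) (k : nat) :
  (forall j : nat, In (d j) (A j)) -> In (prefix n d k) (prefixes n A k).
Proof.
  intros Hd. induction k as [ | k IH]; simpl; [left; reflexivity | ].
  apply in_map_iff. exists (prefix n d k, d k). split; [reflexivity | ].
  apply in_prod; [exact IH | apply Hd].
Qed.

Lemma prefix_ext (n : Z) (d d' : nat -> Z) (k : nat) :
  (forall j : nat, (j < k)%nat -> d j = d' j) -> prefix n d k = prefix n d' k.
Proof.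
  intros H. induction k as [ | k IH]; simpl; [reflexivity | ].
  rewrite IH, H; auto with arith.
Qed.

Lemma prefixes_extend (n : Z) (A : nat -> list Z) (k : nat) (p : Z * Z) :
  (forall j : nat, A j <> nil) -> In p (prefixes n A k) ->
  exists d : nat -> Z, (forall j : nat, In (d j) (A j)) /\ prefix n d k = p.
Proof.
  intros HA. revert p. induction k as [ | k IH]; simpl; intros p Hp.
  - exists (fun j => hd 0%Z (A j)). split.
    + intros j. specialize (HA j). destruct (A j); [congruence | left; reflexivity].
    + destruct Hp as [Hp | []]. exact Hp.
  - apply in_map_iff in Hp. destruct Hp as [[q a] [E Hp]]. simpl in E.
    apply in_prod_iff in Hp. destruct Hp as [Hq Ha].
    destruct (IH q Hq) as [d [Hd Ep]].
    exists (fun j => if Nat.eq_dec j k then a else d j). split.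
    + intros j. destruct (Nat.eq_dec j k) as [-> | ]; [exact Ha | apply Hd].
    + destruct (Nat.eq_dec k k) as [_ | ]; [ | congruence].
      rewrite <- E, <- Ep. f_equal. apply prefix_ext.
      intros j Hj. destruct (Nat.eq_dec j k); [lia | reflexivity].
Qed.

Lemma in_digit_list_abs (n : Z) (A : nat -> list Z) (d : nat -> Z) :
  (forall j : nat, digit_list n (A j)) -> (forall j : nat, In (d j) (A j)) ->
  forall j : nat, (Z.abs (d j) <= n * n)%Z.
Proof.
  intros HA Hd j. destruct (HA j) as [_ [_ Hb]]. specialize (Hb _ (Hd j)). lia.
Qed.

Lemma diam_le_iff (U : C -> Prop) (delta : R) :
  Rbar_le (diam U) (Finite delta) <->
  (forall x y : C, U x -> U y -> Cmod (x - y) <= delta).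
Proof.
  unfold diam. set (E := fun r : R => exists x y : C, U x /\ U y /\ r = Cmod (x - y)).
  destruct (Lub_Rbar_correct E) as [Hub Hlub]. split.
  - intros H x y Hx Hy.
    apply (Rbar_le_trans (Finite (Cmod (x - y))) (Lub_Rbar E) (Finite delta));
      [ | exact H].
    apply Hub. exists x, y. auto.
  - intros H. apply Hlub. intros r [x [y [Hx [Hy ->]]]]. apply H; assumption.
Qed.

Lemma moran_set_covered (n : Z) (A : nat -> list Z) (k : nat) (delta : R) :
  (2 <= n)%Z -> (forall j : nat, digit_list n (A j)) ->
  IZR (2 * (n * n)) / Cmod (base n) ^ k <= delta ->
  covered_by (moran_set n A) delta (length (prefixes n A k)).
Proof.
  intros Hn HA Hdelta.
  pose proof (Cmod_base_ge_2 n Hn) as Hb2.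
  assert (Hp : 0 < Cmod (base n) ^ k) by (apply pow_lt; lra).
  exists (fun i x => Cmod (base n ^ k * x - gauss (nth i (prefixes n A k) (0, 0)%Z))
                     <= IZR (n * n)).
  split.
  - intros i _. apply diam_le_iff. intros x y Hx Hy.
    eapply Rle_trans; [ | exact Hdelta]. apply Rle_div_r; [exact Hp | ].
    rewrite <- Cmod_pow, <- Cmod_mult.
    set (g := gauss (nth i (prefixes n A k) (0, 0)%Z)) in *.
    replace ((x - y) * base n ^ k)%C
      with ((base n ^ k * x - g) - (base n ^ k * y - g))%C by ring.
    eapply Rle_trans; [apply Cmod_triangle | ]. rewrite Cmod_opp, mult_IZR. lra.
  - intros x [d [Hd Hx]].
    destruct (In_nth _ _ (0, 0)%Z (prefix_in_prefixes n A d k Hd)) as [i [Hi Ei]].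
    exists i. split; [exact Hi | ]. rewrite Ei.
    apply expansion_remainder; [exact Hn | | exact Hx].
    apply (in_digit_list_abs n A d HA Hd).
Qed.

Lemma eq_of_mod_eq (a b m : Z) :
  (0 < m)%Z -> (Z.abs (a - b) < m)%Z -> (a mod m = b mod m)%Z -> a = b.
Proof.
  intros Hm Hab E.
  pose proof (Z.div_mod a m ltac:(lia)). pose proof (Z.div_mod b m ltac:(lia)).
  assert (a / m = b / m)%Z by nia. nia.
Qed.

(** Each prefix [g] extends to a point of the set, which lies in some covering
    piece. Two prefixes assigned to the same piece are at distance at most
    [1 + 2 n^2], so their residues modulo [r = 2 n^2 + 2] determine them; the
    piece together with the residues is therefore an injective code. *)
Lemma moran_set_cover_lower (n : Z) (A : nat -> list Z) (k m : nat) (delta : R) :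
  (2 <= n)%Z -> (forall j : nat, digit_list n (A j)) ->
  delta <= / Cmod (base n) ^ k ->
  covered_by (moran_set n A) delta m ->
  (length (prefixes n A k) <=
   m * (Z.to_nat (2 * (n * n) + 2) * Z.to_nat (2 * (n * n) + 2)))%nat.
Proof.
  intros Hn HA Hdelta [U [HU Hcov]].
  pose proof (Cmod_base_ge_2 n Hn) as Hb2.
  assert (Hp : 0 < Cmod (base n) ^ k) by (apply pow_lt; lra).
  set (r := (2 * (n * n) + 2)%Z).
  set (near := fun (g : Z * Z) (i : nat) => (i < m)%nat /\
    exists x : C, U i x /\ Cmod (base n ^ k * x - gauss g) <= IZR (n * n)).
  set (piece := fun g => epsilon (inhabits 0%nat) (near g)).
  assert (Hpiece : forall g, In g (prefixes n A k) -> near g (piece g)).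
  { intros g Hg. apply epsilon_spec.
    destruct (prefixes_extend n A k g ltac:(intros j; apply HA) Hg) as [d [Hd Eg]].
    pose proof (in_digit_list_abs n A d HA Hd) as Hda.
    destruct (expansion_exists n d (n * n) Hn Hda) as [x Hx].
    destruct (Hcov x (ex_intro _ d (conj Hd Hx))) as [i [Hi Ui]].
    exists i. split; [exact Hi | ]. exists x. split; [exact Ui | ].
    rewrite <- Eg. apply expansion_remainder; assumption. }
  set (code := fun g : Z * Z =>
    (piece g, (Z.to_nat (fst g mod r), Z.to_nat (snd g mod r)))).
  assert (Hr : (0 < r)%Z) by (unfold r; nia).
  assert (Hlen : length (prefixes n A k) = length (map code (prefixes n A k)))
    by (rewrite length_map; reflexivity).
  rewrite Hlen. rewrite <- (length_seq m 0), <- (length_seq (Z.to_nat r) 0).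
  rewrite <- !length_prod. apply NoDup_incl_length.
  - apply Injective_map_NoDup_in; [ | apply prefixes_NoDup; exact HA].
    intros g h Hg Hh E. unfold code in E. injection E as E0 E1 E2.
    destruct (Hpiece g Hg) as [_ [x [Ux Hx]]].
    destruct (Hpiece h Hh) as [Hi [y [Uy Hy]]].
    rewrite E0 in Ux.
    pose proof (proj1 (diam_le_iff _ _) (HU _ Hi) x y Ux Uy) as Hxy.
    assert (Hgh : Cmod (gauss (fst g - fst h, snd g - snd h)%Z) <= IZR (2 * (n * n) + 1)).
    { replace (gauss (fst g - fst h, snd g - snd h)%Z) with
        (base n ^ k * (x - y) + ((base n ^ k * y - gauss h) -
           (base n ^ k * x - gauss g)))%C.
      2:{ apply (eq_trans (y := (gauss g - gauss h)%C)); [ring | ].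
          unfold gauss, Cminus, Cplus, Copp; simpl.
          rewrite !minus_IZR. reflexivity. }
      eapply Rle_trans; [apply Cmod_triangle | ].
      rewrite Cmod_mult, Cmod_pow.
      eapply Rle_trans; [apply Rplus_le_compat_l, Cmod_triangle | ].
      rewrite Cmod_opp, plus_IZR, mult_IZR.
      assert (Cmod (base n) ^ k * Cmod (x - y) <= 1).
      { apply (Rle_trans _ (Cmod (base n) ^ k * / Cmod (base n) ^ k)).
        - apply Rmult_le_compat_l; lra.
        - rewrite Rinv_r; lra. }
      lra. }
    pose proof (le_IZR _ _ (Zabs_fst_gauss_le _ _ Hgh)) as Hf.
    pose proof (le_IZR _ _ (Zabs_snd_gauss_le _ _ Hgh)) as Hs.
    cbn [fst snd] in Hf, Hs.
    apply Z2Nat.inj in E1; try (apply Z.mod_pos_bound; exact Hr).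
    apply Z2Nat.inj in E2; try (apply Z.mod_pos_bound; exact Hr).
    apply eq_of_mod_eq in E1; [ | exact Hr | unfold r; lia].
    apply eq_of_mod_eq in E2; [ | exact Hr | unfold r; lia].
    destruct g, h; simpl in *; congruence.
  - intros c Hc. apply in_map_iff in Hc. destruct Hc as [g [<- Hg]].
    destruct (Hpiece g Hg) as [Hi _]. unfold code.
    pose proof (Z.mod_pos_bound (fst g) r Hr). pose proof (Z.mod_pos_bound (snd g) r Hr).
    apply in_prod; [ | apply in_prod]; apply in_seq; lia.
Qed.

Lemma length_prefixes_S (n : Z) (A : nat -> list Z) (k : nat) :
  length (prefixes n A (S k)) = (length (prefixes n A k) * length (A k))%nat.
Proof. simpl. rewrite length_map, length_prod. reflexivity. Qed.

(** * Box dimension from counts of pieces *)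

Lemma covered_by_subset (V W : C -> Prop) (delta : R) (m : nat) :
  (forall x : C, V x -> W x) -> covered_by W delta m -> covered_by V delta m.
Proof. intros HVW [U [HU Hcov]]. exists U. split; auto. Qed.

Lemma covering_number_exists (V : C -> Prop) (delta : R) (m : nat) :
  covered_by V delta m -> exists N : nat, is_covering_number V delta N.
Proof.
  intros Hm.
  destruct (dec_inh_nat_subset_has_unique_least_element (covered_by V delta))
    as [N [[HN Hmin] _]].
  - intros k. apply classic.
  - exists m. exact Hm.
  - exists N. split; assumption.
Qed.

Lemma ln_INR_le (p q : nat) : (0 < p)%nat -> (p <= q)%nat -> ln (INR p) <= ln (INR q).
Proof.
  intros Hp Hpq. apply ln_le; [apply (lt_INR 0), Hp | apply le_INR, Hpq].
Qed.

Lemma exp_le (u v : R) : u <= v -> exp u <= exp v.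
Proof.
  intros [H | ->]; [apply Rlt_le, exp_increasing, H | apply Rle_refl].
Qed.

(** Counts [W k] of pieces at the scales [b^-k] determine the box dimension:
    every [delta < 1] lies between [b^-(k+1)] and [b^-k] for some [k], and the
    constants [c], [K] and [E] change [ln (N delta)] by a bounded amount only,
    which vanishes after division by [- ln delta]. *)
Lemma is_box_dim_of_counts (V : C -> Prop) (b c L E : R) (K : nat) (W : nat -> nat) :
  1 < b -> 0 <= L -> (0 < K)%nat ->
  (forall k : nat, (0 < W k)%nat) ->
  (forall (k : nat) (delta : R), c / b ^ k <= delta -> covered_by V delta (W k)) ->
  (forall (k m : nat) (delta : R), delta <= / b ^ k -> covered_by V delta m ->
     (W k <= m * K)%nat) ->
  (forall k : nat, Rabs (ln (INR (W k)) - INR k * L) <= E) ->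
  is_box_dim V (L / ln b).
Proof.
  intros Hb HL HK HW Hup Hlow HE.
  assert (Hlnb : 0 < ln b) by (rewrite <- ln_1; apply ln_increasing; lra).
  assert (Hcov : forall delta : R, 0 < delta -> exists k : nat, c / b ^ k <= delta).
  { intros delta Hd.
    destruct (inv_pow_small b (delta / (Rabs c + 1)) Hb) as [N HN].
    { apply Rdiv_lt_0_compat; [lra | ]. pose proof (Rabs_pos c). lra. }
    exists N. specialize (HN N (le_n N)). pose proof (Rabs_pos c).
    pose proof (Rle_abs c).
    assert (0 < / b ^ N) by (apply Rinv_0_lt_compat, pow_lt; lra).
    apply Rlt_div_r in HN; [ | lra]. unfold Rdiv. nra. }
  assert (Hr : exists r : nat, c <= b ^ r).
  { destruct (Hcov 1 Rlt_0_1) as [r Hr]. exists r.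
    apply Rle_div_l in Hr; [lra | apply pow_lt; lra]. }
  destruct Hr as [r Hr].
  set (N := fun delta : R => epsilon (inhabits 0%nat) (is_covering_number V delta)).
  assert (HN : forall delta : R, 0 < delta -> is_covering_number V delta (N delta)).
  { intros delta Hd. apply epsilon_spec.
    destruct (Hcov delta Hd) as [k Hk].
    apply (covering_number_exists V delta (W k)), Hup, Hk. }
  exists N. split; [exact HN | ].
  set (T := E + L * (INR r + 1) + ln (INR K)).
  assert (HlnK : 0 <= ln (INR K)).
  { rewrite <- ln_1. apply (ln_INR_le 1); lia. }
  assert (HE0 : 0 <= E) by (eapply Rle_trans; [apply Rabs_pos | apply (HE 0%nat)]).
  (* Below, [t] is the real number with [delta = b^-t]; the shift by [r]
     absorbs the constant [c <= b^r]. *)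
  assert (Hmain : forall delta : R, 0 < delta < 1 ->
    Rabs (ln (INR (N delta)) - (- ln delta / ln b) * L) <= T).
  { intros delta [Hd0 Hd1].
    assert (Hlnd : ln delta < 0) by (rewrite <- ln_1; apply ln_increasing; lra).
    set (t := - ln delta / ln b).
    assert (Ht : 0 < t) by (apply Rdiv_lt_0_compat; lra).
    assert (Etd : delta = exp (- (t * ln b))).
    { unfold t. replace (- (- ln delta / ln b * ln b)) with (ln delta) by (field; lra).
      rewrite exp_ln; lra. }
    assert (Epow : forall j : nat, / b ^ j = exp (- (INR j * ln b))).
    { intros j. rewrite exp_Ropp, <- ln_pow by lra.
      rewrite exp_ln; [reflexivity | apply pow_lt; lra]. }
    destruct (nfloor_ex t (Rlt_le _ _ Ht)) as [k [Hk1 Hk2]].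
    destruct (HN delta Hd0) as [Hc Hmin].
    assert (Hl : (W k <= N delta * K)%nat).
    { apply (Hlow k (N delta) delta); [ | exact Hc].
      rewrite Etd, Epow. apply exp_le. nra. }
    assert (Hu : (N delta <= W (S k + r))%nat).
    { apply Hmin, Hup. rewrite pow_add. unfold Rdiv. rewrite Rinv_mult.
      assert (H0 : 0 < / b ^ S k) by (apply Rinv_0_lt_compat, pow_lt; lra).
      assert (H1 : / b ^ S k <= delta).
      { rewrite Etd, Epow, S_INR. apply exp_le. nra. }
      assert (H2 : c * / b ^ r <= 1).
      { apply (Rle_div_l c 1 (b ^ r)); [apply pow_lt; lra | lra]. }
      nra. }
    assert (HN0 : (0 < N delta)%nat) by (specialize (HW k); nia).
    pose proof (ln_INR_le _ _ (HW k) Hl) as Hl'.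
    rewrite mult_INR, ln_mult in Hl' by (apply (lt_INR 0); assumption).
    pose proof (ln_INR_le _ _ HN0 Hu) as Hu'.
    pose proof (HE k) as HEk. pose proof (HE (S k + r)%nat) as HEu.
    apply Rabs_le_between in HEk, HEu. rewrite plus_INR, S_INR in HEu.
    apply Rabs_le_between. unfold T.
    assert (INR k * L <= t * L) by (apply Rmult_le_compat_r; lra).
    assert (t * L <= (INR k + 1) * L) by (apply Rmult_le_compat_r; lra).
    assert (0 <= L * INR r) by (apply Rmult_le_pos; [lra | apply pos_INR]).
    lra. }
  assert (HT : 0 <= T).
  { unfold T. pose proof (pos_INR r). nra. }
  apply filterlim_locally. intros eps. pose proof (cond_pos eps) as He.
  assert (Hd0 : 0 < Rmin 1 (exp (- ((T + 1) / eps)))).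
  { apply Rmin_pos; [lra | apply exp_pos]. }
  exists (mkposreal _ Hd0). intros delta Hball Hpos.
  change (Rabs (delta - 0) < Rmin 1 (exp (- ((T + 1) / eps)))) in Hball.
  rewrite Rminus_0_r, Rabs_pos_eq in Hball by lra.
  change (Rabs (ln (INR (N delta)) / - ln delta - L / ln b) < eps).
  pose proof (Rmin_l 1 (exp (- ((T + 1) / eps)))) as Hm1.
  pose proof (Rmin_r 1 (exp (- ((T + 1) / eps)))) as Hm2.
  specialize (Hmain delta ltac:(lra)).
  assert (Hln : (T + 1) / eps < - ln delta).
  { assert (ln delta < - ((T + 1) / eps)); [ | lra].
    rewrite <- (ln_exp (- ((T + 1) / eps))). apply ln_increasing; lra. }
  assert (0 < (T + 1) / eps) by (apply Rdiv_lt_0_compat; lra).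
  replace (ln (INR (N delta)) / - ln delta - L / ln b)
    with ((ln (INR (N delta)) - (- ln delta / ln b) * L) * / - ln delta)
    by (field; lra).
  rewrite Rabs_mult, (Rabs_pos_eq (/ - ln delta))
    by (apply Rlt_le, Rinv_0_lt_compat; lra).
  apply Rlt_div_l; [lra | ].
  apply Rlt_div_l in Hln; [ | lra]. lra.
Qed.

Lemma length_prefixes_pos (n : Z) (A : nat -> list Z) (k : nat) :
  (forall j : nat, A j <> nil) -> (0 < length (prefixes n A k))%nat.
Proof.
  intros HA. induction k as [ | k IH]; [simpl; lia | ].
  rewrite length_prefixes_S. specialize (HA k).
  destruct (A k); [congruence | simpl length; nia].
Qed.

Lemma ln_length_prefixes_S (n : Z) (A : nat -> list Z) (k : nat) :
  (forall j : nat, A j <> nil) ->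
  ln (INR (length (prefixes n A (S k)))) =
  ln (INR (length (prefixes n A k))) + ln (INR (length (A k))).
Proof.
  intros HA. rewrite length_prefixes_S, mult_INR.
  apply ln_mult; apply (lt_INR 0).
  - apply length_prefixes_pos, HA.
  - specialize (HA k). destruct (A k); [congruence | simpl; lia].
Qed.

Lemma moran_set_box_dim (n : Z) (A : nat -> list Z) (V : C -> Prop) (L E : R) :
  (2 <= n)%Z -> (forall j : nat, digit_list n (A j)) ->
  (forall x : C, V x <-> moran_set n A x) -> 0 <= L ->
  (forall k : nat, Rabs (ln (INR (length (prefixes n A k))) - INR k * L) <= E) ->
  is_box_dim V (L / ln (Cmod (base n))).
Proof.
  intros Hn HA HV HL HE. pose proof (Cmod_base_ge_2 n Hn) as Hb2.
  apply (is_box_dim_of_counts V _ (IZR (2 * (n * n))) L E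
           (Z.to_nat (2 * (n * n) + 2) * Z.to_nat (2 * (n * n) + 2))
           (fun k => length (prefixes n A k))); [lra | exact HL | nia | | | | exact HE].
  - intros k. apply length_prefixes_pos. intros j. apply HA.
  - intros k delta H. apply (covered_by_subset V (moran_set n A)).
    + intros x. apply HV.
    + apply moran_set_covered; assumption.
  - intros k m delta H Hc. apply (moran_set_cover_lower n A k m delta Hn HA H).
    apply (covered_by_subset (moran_set n A) V); [ | exact Hc].
    intros x. apply HV.
Qed.

(** * Digitwise overlaps *)

Lemma expansion_minus (n M : Z) (d d' : nat -> Z) (z z' : C) :
  (2 <= n)%Z -> (forall k : nat, (Z.abs (d k) <= M)%Z) ->
  (forall k : nat, (Z.abs (d' k) <= M)%Z) ->
  expansion n d z -> expansion n d' z' ->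
  expansion n (fun k => d k - d' k)%Z (z - z').
Proof.
  intros Hn Hd Hd' Hz Hz'. apply (expansion_of_remainder n _ (2 * IZR M) _ Hn).
  intros k. rewrite prefix_minus.
  pose proof (expansion_remainder n d M z Hn Hd Hz k) as H.
  pose proof (expansion_remainder n d' M z' Hn Hd' Hz' k) as H'.
  set (p := gauss (prefix n d k)) in *. set (p' := gauss (prefix n d' k)) in *.
  replace (base n ^ k * (z - z') - (p - p'))%C
    with ((base n ^ k * z - p) - (base n ^ k * z' - p'))%C by ring.
  eapply Rle_trans; [apply Cmod_triangle | ]. rewrite Cmod_opp. lra.
Qed.

Lemma expansion_close (n M : Z) (d d' : nat -> Z) (z z' : C) (m : nat) :
  (2 <= n)%Z -> (forall k : nat, (Z.abs (d k) <= M)%Z) ->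
  (forall k : nat, (Z.abs (d' k) <= M)%Z) ->
  expansion n d z -> expansion n d' z' ->
  (forall k : nat, (k < m)%nat -> d k = d' k) ->
  Cmod (z - z') <= 2 * IZR M / Cmod (base n) ^ m.
Proof.
  intros Hn Hd Hd' Hz Hz' E. pose proof (Cmod_base_ge_2 n Hn) as Hb2.
  apply Rle_div_r; [apply pow_lt; lra | ]. rewrite <- Cmod_pow, <- Cmod_mult.
  pose proof (expansion_remainder n d M z Hn Hd Hz m) as H.
  pose proof (expansion_remainder n d' M z' Hn Hd' Hz' m) as H'.
  rewrite (prefix_ext n d d' m E) in H.
  set (p' := gauss (prefix n d' m)) in *.
  replace ((z - z') * base n ^ m)%C
    with ((base n ^ m * z - p') - (base n ^ m * z' - p'))%C by ring.
  eapply Rle_trans; [apply Cmod_triangle | ]. rewrite Cmod_opp. lra.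
Qed.

Definition overlap (l : list Z) (t : Z) : list Z :=
  filter (fun a => if in_dec Z.eq_dec (a - t)%Z l then true else false) l.

Lemma in_overlap (l : list Z) (t a : Z) :
  In a (overlap l t) <-> In a l /\ In (a - t)%Z l.
Proof.
  unfold overlap. rewrite filter_In.
  destruct (in_dec Z.eq_dec (a - t)%Z l); intuition congruence.
Qed.

Lemma overlap_0 (l : list Z) : overlap l 0 = l.
Proof.
  unfold overlap. apply forallb_filter_id, forallb_forall. intros a Ha.
  rewrite Z.sub_0_r. destruct (in_dec Z.eq_dec a l); [reflexivity | contradiction].
Qed.

Lemma finite_Z_list (P : Z -> Prop) (m : nat) :
  (forall a : Z, P a -> (0 <= a < Z.of_nat m)%Z) ->
  exists l : list Z, NoDup l /\ forall a : Z, In a l <-> P a.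
Proof.
  intros HP.
  exists (filter (fun a => if excluded_middle_informative (P a) then true else false)
            (map Z.of_nat (seq 0 m))).
  split.
  - apply NoDup_filter, Injective_map_NoDup; [ | apply seq_NoDup].
    intros i j. lia.
  - intros a. rewrite filter_In, in_map_iff.
    destruct (excluded_middle_informative (P a)) as [Ha | Ha].
    + split; [tauto | intros _]. split; [ | reflexivity].
      exists (Z.to_nat a). specialize (HP a Ha). rewrite in_seq. lia.
    + split; [intros [_ H]; discriminate | tauto].
Qed.

Lemma list_max_exists (l : list Z) :
  l <> nil -> exists x : Z, In x l /\ forall a : Z, In a l -> (a <= x)%Z.
Proof.
  induction l as [ | a l IH]; [congruence | intros _].
  destruct l as [ | b l].
  - exists a. split; [left; reflexivity | ]. intros c [-> | []]. lia.
  - destruct IH as [x [Hx Hmax]]; [congruence | ].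
    destruct (Z.le_gt_cases x a).
    + exists a. split; [left; reflexivity | ].
      intros c [-> | Hc]; [lia | ]. specialize (Hmax c Hc). lia.
    + exists x. split; [right; exact Hx | ].
      intros c [-> | Hc]; [lia | ]. apply Hmax, Hc.
Qed.

Lemma list_min_exists (l : list Z) :
  l <> nil -> exists x : Z, In x l /\ forall a : Z, In a l -> (x <= a)%Z.
Proof.
  intros Hl. destruct (list_max_exists (map Z.opp l)) as [x [Hx Hmax]].
  { destruct l; simpl; congruence. }
  apply in_map_iff in Hx. destruct Hx as [y [<- Hy]].
  exists y. split; [exact Hy | ]. intros a Ha.
  specialize (Hmax (- a)%Z (in_map Z.opp l a Ha)). lia.
Qed.

(** The translation by the largest difference [max - min] leaves only the
    maximum in common. *)
Lemma singleton_overlap_exists (l : list Z) :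
  NoDup l -> l <> nil ->
  exists a a' : Z, In a l /\ In a' l /\ length (overlap l (a - a')) = 1%nat.
Proof.
  intros Hnd Hl.
  destruct (list_max_exists l Hl) as [a [Ha Hmax]].
  destruct (list_min_exists l Hl) as [a' [Ha' Hmin]].
  exists a, a'. split; [exact Ha | split; [exact Ha' | ]].
  assert (H : forall c, In c (overlap l (a - a')) <-> c = a).
  { intros c. rewrite in_overlap. split.
    - intros [Hc Hc']. specialize (Hmax c Hc). specialize (Hmin _ Hc'). lia.
    - intros ->. split; [exact Ha | ]. replace (a - (a - a'))%Z with a' by lia. exact Ha'. }
  apply Nat.le_antisymm.
  - apply (NoDup_incl_length (l' := a :: nil)).
    + apply NoDup_filter, Hnd.
    + intros c Hc. left. symmetry. apply H, Hc.
  - apply (NoDup_incl_length (l := a :: nil)).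
    + constructor; [intros [] | constructor].
    + intros c [<- | []]. apply H. reflexivity.
Qed.

(** * Digits of prescribed density *)

(** The jumps of [beatty beta] form a set of indices of density [beta] with
    bounded discrepancy. *)
Definition beatty (beta : R) (k : nat) : Z := Int_part (INR k * beta).

Lemma beatty_bounds (beta : R) (k : nat) :
  INR k * beta - 1 < IZR (beatty beta k) <= INR k * beta.
Proof. unfold beatty. pose proof (base_Int_part (INR k * beta)). lra. Qed.

Lemma beatty_step (beta : R) (k : nat) : 0 <= beta <= 1 ->
  beatty beta (S k) = beatty beta k \/ beatty beta (S k) = (beatty beta k + 1)%Z.
Proof.
  intros Hb. pose proof (beatty_bounds beta k) as H.
  pose proof (beatty_bounds beta (S k)) as H'. rewrite S_INR in H'.
  assert (beatty beta k < beatty beta (S k) + 1)%Z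
    by (apply lt_IZR; rewrite plus_IZR; lra).
  assert (beatty beta (S k) < beatty beta k + 2)%Z
    by (apply lt_IZR; rewrite plus_IZR; lra).
  lia.
Qed.

Lemma beatty_0 (beta : R) : beatty beta 0 = 0%Z.
Proof.
  pose proof (beatty_bounds beta 0) as H. simpl in H.
  assert (-1 < beatty beta 0)%Z by (apply lt_IZR; lra).
  assert (beatty beta 0 <= 0)%Z by (apply le_IZR; lra). lia.
Qed.

(** From level [m] on, the logarithm of the count grows by [ln q] exactly when
    [beatty beta] jumps. Each of the first [m] levels contributes an error of
    at most [ln q], and replacing [beatty beta k] by [k * beta] one more. *)
Lemma beatty_log_growth (n : Z) (A : nat -> list Z) (q m : nat) (beta : R) :
  (forall j : nat, digit_list n (A j)) -> 0 <= beta <= 1 ->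
  (forall j : nat, (length (A j) <= q)%nat) ->
  (forall j : nat, (m <= j)%nat ->
     length (A j) = if Z.eq_dec (beatty beta (S j)) (beatty beta j) then 1%nat else q) ->
  forall k : nat,
    Rabs (ln (INR (length (prefixes n A k))) - INR k * (beta * ln (INR q)))
    <= (INR m + 1) * ln (INR q).
Proof.
  intros HA Hbeta Hq Htail.
  assert (Hne : forall j, A j <> nil) by (intros j; apply HA).
  assert (Hpos : forall j, (0 < length (A j))%nat).
  { intros j. specialize (Hne j). destruct (A j); [congruence | simpl; lia]. }
  assert (HL : 0 <= ln (INR q)).
  { rewrite <- ln_1. apply (ln_INR_le 1); [lia | ].
    specialize (Hpos 0%nat). specialize (Hq 0%nat). lia. }
  assert (H : forall k : nat,
    Rabs (ln (INR (length (prefixes n A k))) - IZR (beatty beta k) * ln (INR q))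
    <= INR (Nat.min k m) * ln (INR q)).
  { intros k. induction k as [ | k IH].
    - rewrite beatty_0. simpl. rewrite ln_1, Rmult_0_l, Rminus_0_r, Rabs_R0. lra.
    - rewrite ln_length_prefixes_S by exact Hne.
      apply Rabs_le_between in IH. apply Rabs_le_between.
      destruct (Nat.le_gt_cases m k) as [Hmk | Hmk].
      + rewrite Nat.min_r in * by lia. rewrite (Htail k Hmk).
        destruct (Z.eq_dec _ _) as [-> | Hne'].
        * simpl INR. rewrite ln_1. lra.
        * destruct (beatty_step beta k Hbeta) as [E | E]; [contradiction | ].
          rewrite E, plus_IZR. lra.
      + rewrite Nat.min_l in * by lia. rewrite S_INR.
        pose proof (ln_INR_le _ _ (Hpos k) (Hq k)) as H1.
        pose proof (ln_INR_le 1 _ (Nat.lt_0_1) (Hpos k)) as H2.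
        simpl INR in H2. rewrite ln_1 in H2.
        destruct (beatty_step beta k Hbeta) as [-> | ->]; rewrite ?plus_IZR; lra. }
  intros k. specialize (H k).
  assert (INR (Nat.min k m) * ln (INR q) <= INR m * ln (INR q)).
  { apply Rmult_le_compat_r; [exact HL | apply le_INR; lia]. }
  pose proof (beatty_bounds beta k) as Hb.
  apply Rabs_le_between in H. apply Rabs_le_between.
  assert ((INR k * beta - 1) * ln (INR q) <= IZR (beatty beta k) * ln (INR q)
          <= INR k * beta * ln (INR q)) by (split; apply Rmult_le_compat_r; lra).
  lra.
Qed.

(** * Self-intersections and density *)

Lemma radix_set_iff (n : Z) (D : Z -> Prop) (l : list Z) (x : C) :
  (forall a : Z, In a l <-> D a) ->
  radix_set (base n) D x <-> moran_set n (fun _ => l) x.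
Proof.
  intros Hl. split; intros [d [Hd Hx]]; exists d; (split; [ | exact Hx]);
    intros k; apply Hl, Hd.
Qed.

Lemma difference_expansion (n : Z) (D : Z -> Prop) (x y : C) :
  (2 <= n)%Z -> (forall d : Z, D d -> (0 <= d /\ 2 * d <= n * n)%Z) ->
  radix_set (base n) D x -> radix_set (base n) D y ->
  exists d d' : nat -> Z,
    (forall k : nat, D (d k)) /\ (forall k : nat, D (d' k)) /\
    expansion n d x /\ expansion n (fun k => d k - d' k)%Z (x - y).
Proof.
  intros Hn HD [d [Hd Hx]] [d' [Hd' Hy]]. exists d, d'.
  split; [exact Hd | split; [exact Hd' | split; [exact Hx | ]]].
  apply (expansion_minus n (n * n)); try assumption.
  - intros k. pose proof (HD _ (Hd k)). lia.
  - intros k. pose proof (HD _ (Hd' k)). lia.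
Qed.

(** A point [x = y + w] with [x] and [y] in [C_D] yields an expansion of [w]
    whose digits are the differences of those of [x] and [y]; by uniqueness
    these differences are the [t k]. *)
Lemma self_intersection_iff (n : Z) (D : Z -> Prop) (l : list Z) (t : nat -> Z) (w x : C) :
  (2 <= n)%Z -> (forall d : Z, D d -> (0 <= d /\ 2 * d <= n * n)%Z) ->
  (forall a a' : Z, difference_set D a -> difference_set D a' ->
     Z.abs (a - a') <> 1%Z) ->
  (forall a : Z, In a l <-> D a) ->
  (forall k : nat, difference_set D (t k)) -> expansion n t w ->
  self_intersection (radix_set (base n) D) w x <->
  moran_set n (fun k => overlap l (t k)) x.
Proof.
  intros Hn HD Hsep Hl Ht Hw.
  assert (Hdiff : forall a, difference_set D a -> (2 * Z.abs a <= n * n)%Z).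
  { intros a [c [c' [Hc [Hc' ->]]]]. pose proof (HD _ Hc). pose proof (HD _ Hc'). lia. }
  split.
  - intros [Hx [y [Hy E]]].
    destruct (difference_expansion n D x y Hn HD Hx Hy) as [d [d' [Hd [Hd' [Ex Exy]]]]].
    assert (Hdd : forall k, difference_set D (d k - d' k)).
    { intros k. exists (d k), (d' k). auto. }
    replace (x - y)%C with w in Exy by (rewrite E; ring).
    assert (Et : forall k, t k = (d k - d' k)%Z).
    { apply (expansion_unique n (n * n) t (fun k => d k - d' k)%Z w); try assumption;
        intros k; pose proof (Hdiff _ (Ht k)); pose proof (Hdiff _ (Hdd k)); [lia | lia | lia | ].
      apply Hsep; auto. }
    exists d. split; [ | exact Ex]. intros k. apply in_overlap.
    rewrite (Et k). replace (d k - (d k - d' k))%Z with (d' k) by lia.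
    split; apply Hl; auto.
  - intros [d [Hd Hx]].
    assert (Hd1 : forall k, D (d k)).
    { intros k. apply Hl. specialize (Hd k). rewrite in_overlap in Hd. tauto. }
    assert (Hd2 : forall k, D (d k - t k)%Z).
    { intros k. apply Hl. specialize (Hd k). rewrite in_overlap in Hd. tauto. }
    split; [exists d; auto | ].
    exists (x - w)%C. split; [ | ring].
    exists (fun k => d k - t k)%Z. split; [exact Hd2 | ].
    apply (expansion_minus n (n * n)); try assumption.
    + intros k. pose proof (HD _ (Hd1 k)). lia.
    + intros k. pose proof (Hdiff _ (Ht k)). lia.
Qed.

Theorem corollary0p4 :
  forall (n : Z) (D : Z -> Prop),
    (2 <= n)%Z ->
    (exists d : Z, D d) ->
    (forall d : Z, D d -> (0 <= d)%Z /\ IZR d <= Cmod (base n) ^ 2 - 1) ->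
    (forall d : Z, D d -> IZR d <= IZR n ^ 2 / 2) ->
    (forall a a' : Z, difference_set D a -> difference_set D a' ->
       Z.abs (a - a') <> 1%Z) ->
    forall beta : R, 0 <= beta <= 1 ->
      dense_in (F_level (radix_set (base n) D) beta)
               (F (radix_set (base n) D)).
Proof.
  intros n D Hn [d0 Hd0] Hrange Hhalf Hsep beta Hbeta z [x [Hx [y [Hy Exyz]]]] eps Heps.
  pose proof (Cmod_base_ge_2 n Hn) as Hb2.
  assert (HD : forall d : Z, D d -> (0 <= d /\ 2 * d <= n * n)%Z).
  { intros d Hd. split; [apply Hrange, Hd | ].
    apply le_IZR. rewrite !mult_IZR. pose proof (Hhalf d Hd). lra. }
  destruct (finite_Z_list D (Z.to_nat (n * n + 1))) as [l [Hnd Hl]].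
  { intros a Ha. pose proof (HD a Ha). lia. }
  assert (Hlne : l <> nil).
  { intros E. apply Hl in Hd0. rewrite E in Hd0. exact Hd0. }
  destruct (singleton_overlap_exists l Hnd Hlne) as [c [c' [Hc [Hc' Hone]]]].
  destruct (difference_expansion n D x y Hn HD Hx Hy) as [d [d' [Hd [Hd' [_ Exy]]]]].
  replace (x - y)%C with z in Exy by (rewrite Exyz; ring).
  destruct (inv_pow_small (Cmod (base n)) (eps / (2 * IZR (n * n)))) as [m Hm]; [lra | | ].
  { apply Rdiv_lt_0_compat; [exact Heps | ]. rewrite <- mult_IZR. apply IZR_lt. nia. }
  specialize (Hm m (le_n m)).
  (* The digits of [z] up to [m], then [0] at the jumps and the largest
     difference elsewhere. *)
  set (t := fun k : nat =>
    if lt_dec k m then (d k - d' k)%Z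
    else if Z.eq_dec (beatty beta (S k)) (beatty beta k) then (c - c')%Z else 0%Z).
  assert (Ht : forall k : nat, difference_set D (t k)).
  { intros k. unfold t. destruct (lt_dec k m).
    - exists (d k), (d' k). auto.
    - destruct (Z.eq_dec _ _).
      + exists c, c'. rewrite <- !Hl. auto.
      + exists d0, d0. split; [ | split]; [assumption | assumption | lia]. }
  assert (Htb : forall k : nat, (Z.abs (t k) <= n * n)%Z).
  { intros k. destruct (Ht k) as [a [a' [Ha [Ha' ->]]]].
    pose proof (HD _ Ha). pose proof (HD _ Ha'). lia. }
  destruct (expansion_exists n t (n * n) Hn Htb) as [w Hw].
  set (A := fun k : nat => overlap l (t k)).
  assert (HA : forall j : nat, digit_list n (A j)).
  { intros j. split; [ | split].
    - apply NoDup_filter, Hnd.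
    - destruct (Ht j) as [a [a' [Ha [Ha' E]]]].
      assert (H : In a (A j)).
      { apply in_overlap. rewrite E. replace (a - (a - a'))%Z with a' by lia.
        rewrite !Hl. auto. }
      intros H0. rewrite H0 in H. exact H.
    - intros a Ha. apply in_overlap in Ha. destruct Ha as [Ha _].
      apply Hl, HD in Ha. lia. }
  assert (Hlist : digit_list n l).
  { split; [exact Hnd | split; [exact Hlne | ]].
    intros a Ha. apply Hl, HD in Ha. lia. }
  assert (HL : 0 <= ln (INR (length l))).
  { rewrite <- ln_1. apply (ln_INR_le 1); [lia | ].
    destruct l; [congruence | simpl; lia]. }
  pose proof (fun u => self_intersection_iff n D l t w u Hn HD Hsep Hl Ht Hw) as Hint.
  exists w. split; [split | ].
  - destruct (prefixes_extend n A 0 (0, 0)%Z ltac:(intros j; apply HA)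
                ltac:(left; reflexivity)) as [u [Hu _]].
    destruct (expansion_exists n u (n * n) Hn (in_digit_list_abs n A u HA Hu)) as [v Hv].
    exists v. apply Hint. exists u. auto.
  - exists (ln (INR (length l)) / ln (Cmod (base n))). split.
    + apply (moran_set_box_dim n (fun _ => l) _ _ 0 Hn); [auto | | exact HL | ].
      * intros u. apply radix_set_iff, Hl.
      * intros k. right. replace (_ - _) with 0; [apply Rabs_R0 | ].
        induction k as [ | k IH].
        -- simpl. rewrite ln_1. ring.
        -- rewrite ln_length_prefixes_S, S_INR by auto. lra.
    + replace (beta * (ln (INR (length l)) / ln (Cmod (base n))))
        with (beta * ln (INR (length l)) / ln (Cmod (base n)))
        by (unfold Rdiv; ring).
      apply (moran_set_box_dim n A _ _ ((INR m + 1) * ln (INR (length l))) Hn HA);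
        [exact Hint | apply Rmult_le_pos; lra | ].
      apply beatty_log_growth; [exact HA | exact Hbeta | | ].
      * intros j. apply filter_length_le.
      * intros j Hj. unfold A, t. destruct (lt_dec j m); [lia | ].
        destruct (Z.eq_dec _ _); [exact Hone | rewrite overlap_0; reflexivity].
  - eapply Rle_lt_trans.
    + apply (expansion_close n (n * n) t (fun k => d k - d' k)%Z w z m Hn Htb);
        [ | exact Hw | exact Exy | ].
      * intros k. pose proof (HD _ (Hd k)). pose proof (HD _ (Hd' k)). lia.
      * intros k Hk. unfold t. destruct (lt_dec k m); [reflexivity | lia].
    + assert (0 < 2 * IZR (n * n)) by (rewrite <- mult_IZR; apply IZR_lt; nia).
      apply Rlt_div_r in Hm; [ | assumption]. unfold Rdiv. lra.
Qed.
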